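(* Let $A_1,\dots,A_4,B_1,\dots,B_4\subseteq\mathbf{Z}_{109}$ be the explicit subsets defined in the context. Then the two $436\times 436$ matrices $GS([A_1],[A_2],[A_3],[A_4])$ and $GS([B_1],[B_2],[B_3],[B_4])$, obtained by substituting the circulant matrices $[A_i]$, respectively $[B_i]$, for $P_i$ in the Goethals--Seidel array, are skew-Hadamard matrices of order $436$.
   Context: A Hadamard matrix of order $m$ is an $m\times m$ matrix $A$ with entries in $\{1,-1\}$ such that $AA^T=mI_m$, where $T$ denotes the transpose and $I_m$ the identity matrix. A skew-Hadamard matrix is a Hadamard matrix $A$ such that $A-I_m$ is skew-symmetric. $\mathbf{Z}_n$ denotes the ring of integers modulo $n$, and $\mathbf{Z}_n^*$ its group of invertible elements. For $X\subseteq\mathbf{Z}_n$ let $a_X=(a_0,a_1,\dots,a_{n-1})$ be the $\{\pm1\}$-row vector with $a_i=-1$ if and only if $i\in X$; $[X]$ denotes the $n\times n$ circulant matrix with first row $a_X$ (i.e. its $(i,j)$ entry is $a_{j-i \bmod n}$). $R$ denotes the $n\times n$ matrix with ones on the back-diagonal and all other entries zero. For $n\times n$ matrices $P_1,P_2,P_3,P_4$ the Goethals--Seidel array is the $4n\times 4n$ matrix $$GS(P_1,P_2,P_3,P_4)=\left[\begin{array}{cccc} P_1 & P_2R & P_3R & P_4R\\ -P_2R & P_1 & -P_4^TR & P_3^TR\\ -P_3R & P_4^TR & P_1 & -P_2^TR\\ -P_4R & -P_3^TR & P_2^TR & P_1\end{array}\right].$$ Let $n=109$ and let $H=\{1,45,63\}$,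 the subgroup of order $3$ of $\mathbf{Z}_{109}^*$. The $36$ cosets $\alpha_0,\dots,\alpha_{35}$ of $H$ in $\mathbf{Z}_{109}^*$ are enumerated as follows: $\alpha_0=H$, $\alpha_2=2H$, $\alpha_4=3H$, $\alpha_6=4H$, $\alpha_8=5H$, $\alpha_{10}=6H$, $\alpha_{12}=8H$, $\alpha_{14}=9H$, $\alpha_{16}=10H$, $\alpha_{18}=11H$, $\alpha_{20}=13H$, $\alpha_{22}=15H$, $\alpha_{24}=16H$, $\alpha_{26}=18H$, $\alpha_{28}=20H$, $\alpha_{30}=23H$, $\alpha_{32}=25H$, $\alpha_{34}=30H$, and $\alpha_{2i+1}=-\alpha_{2i}$ for $0\le i\le 17$. For $k=1,2,3,4$ set $A_k=\bigcup_{i\in J_k}\alpha_i$ and $B_k=\bigcup_{i\in L_k}\alpha_i$, where $J_1=\{0,2,5,7,8,10,12,15,16,19,20,23,24,26,29,30,33,34\}$, $J_2=\{4,5,6,7,11,15,18,19,20,22,25,30,32,33,35\}$, $J_3=\{0,1,5,6,9,10,11,14,17,20,24,26,27,28,29,31,32\}$, $J_4=\{0,3,4,6,7,9,10,12,13,22,24,25,26,27,28,29,31,33,35\}$, $L_1=\{0,3,5,6,9,10,13,15,16,18,21,23,24,27,28,30,32,34\}$, $L_2=\{1,4,5,6,7,8,10,11,12,13,16,19,20,21,25,27,30,31,34\}$, $L_3=\{0,1,2,3,4,6,10,12,13,15,16,17,20,22,23,24,25,29,34,35\}$, $L_4=\{0,1,2,3,5,8,9,12,13,14,15,16,19,21,23,25,26,28,29,33,34\}$.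 *)

(* Defs.v *)
From mathcomp Require Import all_boot all_order all_algebra.

Set Implicit Arguments.
Unset Strict Implicit.
Unset Printing Implicit Defensive.

Import GRing.Theory.
Local Open Scope ring_scope.

Definition hadamard (m : nat) (A : 'M[int]_m) : Prop :=
  (forall i j, A i j = 1 \/ A i j = -1) /\ A *m A^T = (m%:R)%:M.

Definition skew_symmetric (m : nat) (A : 'M[int]_m) : Prop := A^T = - A.

Definition skew_hadamard (m : nat) (A : 'M[int]_m) : Prop :=
  hadamard A /\ skew_symmetric (A - 1%:M).

Definition pm_vec (n : nat) (X : {set 'Z_n}) (i : 'Z_n) : int :=
  if i \in X then -1 else 1.

(* Rows and columns are indexed by 'I_n and their difference is taken in 'Z_n,
   so this is the intended circulant only for 1 < n. *)
Definition circ (n : nat) (X : {set 'Z_n}) : 'M[int]_n :=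
  \matrix_(i, j) pm_vec X ((j : nat)%:R - (i : nat)%:R).

Definition back_diag (n : nat) : 'M[int]_n :=
  \matrix_(i, j) (j == rev_ord i)%:R.

(* The 4 x 4 array is split into its four 2 x 2 quadrants: upper left,
   upper right, lower left, lower right. *)
Definition GS (n : nat) (P1 P2 P3 P4 : 'M[int]_n) : 'M[int]_(n + n + (n + n)) :=
  let R := back_diag n in
  block_mx
    (block_mx         P1         (P2 *m R)
              (- (P2 *m R))          P1)
    (block_mx    (P3 *m R)       (P4 *m R)
              (- (P4^T *m R)) (P3^T *m R))
    (block_mx (- (P3 *m R))    (P4^T *m R)
              (- (P4 *m R)) (- (P3^T *m R)))
    (block_mx         P1    (- (P2^T *m R))
                 (P2^T *m R)         P1).

Definition H : {set 'Z_109} := [set 1; 45; 63].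

(* The representative of the coset alpha_(2i) is the entry of index i. *)
Definition coset_reps : seq 'Z_109 :=
  [:: 1; 2; 3; 4; 5; 6; 8; 9; 10; 11; 13; 15; 16; 18; 20; 23; 25; 30].

Definition even_coset (i : nat) : {set 'Z_109} :=
  [set coset_reps`_i * h | h in H].

Definition alpha (k : nat) : {set 'Z_109} :=
  if odd k then [set - x | x in even_coset k./2] else even_coset k./2.

Definition coset_union (J : seq nat) : {set 'Z_109} :=
  \bigcup_(i <- J) alpha i.

Definition A1 := coset_union
  [:: 0; 2; 5; 7; 8; 10; 12; 15; 16; 19; 20; 23; 24; 26; 29; 30; 33; 34]%N.
Definition A2 := coset_union
  [:: 4; 5; 6; 7; 11; 15; 18; 19; 20; 22; 25; 30; 32; 33; 35]%N.
Definition A3 := coset_union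
  [:: 0; 1; 5; 6; 9; 10; 11; 14; 17; 20; 24; 26; 27; 28; 29; 31; 32]%N.
Definition A4 := coset_union
  [:: 0; 3; 4; 6; 7; 9; 10; 12; 13; 22; 24; 25; 26; 27; 28; 29; 31; 33; 35]%N.

Definition B1 := coset_union
  [:: 0; 3; 5; 6; 9; 10; 13; 15; 16; 18; 21; 23; 24; 27; 28; 30; 32; 34]%N.
Definition B2 := coset_union
  [:: 1; 4; 5; 6; 7; 8; 10; 11; 12; 13; 16; 19; 20; 21; 25; 27; 30; 31; 34]%N.
Definition B3 := coset_union
  [:: 0; 1; 2; 3; 4; 6; 10; 12; 13; 15; 16; 17; 20; 22; 23; 24; 25; 29; 34;
      35]%N.
Definition B4 := coset_union
  [:: 0; 1; 2; 3; 5; 8; 9; 12; 13; 14; 15; 16; 19; 21; 23; 25; 26; 28; 29; 33;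
      34]%N.

(* Main.v *)
Require Import Defs.
From mathcomp Require Import all_boot all_order all_algebra.
From mathcomp Require Import ring.

Set Implicit Arguments.
Unset Strict Implicit.
Unset Printing Implicit Defensive.

Import GRing.Theory.
Local Open Scope ring_scope.

(** The Goethals-Seidel array turns four circulant sign matrices P1, ..., P4
    with P1 P1^T + ... + P4 P4^T = 4n I into a Hadamard matrix of order 4n,
    because circulant matrices commute, their transposes are circulant, and the
    back-diagonal matrix R exchanges a circulant with its transpose:
    R P = P^T R.  In the Gram matrix of the array all factors R can therefore be
    moved to the right, where they cancel in pairs or leave one R; the
    off-diagonal blocks then vanish by commutativity and each diagonal block is
    P1 P1^T + ... + P4 P4^T ([GS_gram]).  Since P R is symmetric for a circulant
    P, the array minus the identity is skew-symmetric as soon as P1 - I is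
    ([GS_skew]).

    The entries of P P^T are the periodic autocorrelations of the first row of
    P, and for a sign sequence of length n the autocorrelation at shift s is
    n - 2 d, where d counts the positions at which the sequence differs from its
    rotation by s ([autocorrelation]).  The Gram condition thus says that the
    four counts add up to 2n for every nonzero shift, and
    [GS_circ_skew_hadamard] leaves two finite combinatorial conditions on the
    four subsets.  For n = 109 these are decided by evaluation on the indicator
    sequences of the given unions of cosets ([certificate_skew_hadamard]). *)

(** * Circulant matrices and the back-diagonal *)

(** Stating the theory for arbitrary functions, and for ordinals below m.+2,
    makes the transpose of a circulant again an instance, and makes the index
    type of the matrix coincide with the ring of integers modulo its order. *)
Definition circulant (m : nat) (a : 'I_m.+2 -> int) : 'M[int]_m.+2 :=
  \matrix_(i, j) a (j - i).

Lemma circE (m : nat) (X : {set 'Z_m.+2}) : circ X = circulant (pm_vec X).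
Proof. by apply/matrixP => i j; rewrite !mxE !(natr_Zp (_ : 'Z_m.+2)). Qed.

Lemma tr_circulant (m : nat) (a : 'I_m.+2 -> int) :
  (circulant a)^T = circulant (a \o -%R).
Proof. by apply/matrixP => i j; rewrite !mxE /= opprB. Qed.

(** Both products are the cyclic convolution of a and b; the reflection
    k |-> i + j - k of the summation index exchanges the two factors. *)
Lemma circulantC (m : nat) (a b : 'I_m.+2 -> int) :
  circulant a *m circulant b = circulant b *m circulant a.
Proof.
apply/matrixP => i j; rewrite !mxE.
rewrite (reindex_inj (inv_inj (subKr (i + j)))) /=.
apply: eq_bigr => k _; rewrite !mxE mulrC.
by congr (b _ * a _); ring.
Qed.

Lemma mulmx_back_diag (n p : nat) (M : 'M[int]_(p, n)) (i : 'I_p) (j : 'I_n) :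
  (M *m back_diag n) i j = M i (rev_ord j).
Proof.
rewrite mxE (bigD1 (rev_ord j)) //= mxE rev_ordK eqxx mulr1 big1 ?addr0 // => k.
rewrite mxE -[j == _](inj_eq rev_ord_inj) rev_ordK eq_sym => /negbTE->.
by rewrite mulr0.
Qed.

Lemma tr_back_diag (n : nat) : (back_diag n)^T = back_diag n.
Proof.
by apply/matrixP => i j; rewrite !mxE -(inj_eq rev_ord_inj) rev_ordK eq_sym.
Qed.

Lemma back_diag_sq (n : nat) : back_diag n *m back_diag n = 1%:M.
Proof.
apply/matrixP => i j.
by rewrite mulmx_back_diag !mxE (inj_eq rev_ord_inj) eq_sym.
Qed.

Lemma rev_ordE (m : nat) (i : 'I_m.+2) : rev_ord i = - 1 - i.
Proof.
suff sum0 : rev_ord i + (1 + i) = 0.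
  by rewrite -opprD; apply/eqP; rewrite -addr_eq0 sum0.
apply: val_inj => /=.
by rewrite modnDml modnDmr add1n subnK ?modnn.
Qed.

(** Reversing the columns turns the entries a (j - i) into a (- 1 - j - i),
    which is symmetric in i and j. *)
Lemma tr_circulant_back_diag (m : nat) (a : 'I_m.+2 -> int) :
  (circulant a *m back_diag m.+2)^T = circulant a *m back_diag m.+2.
Proof.
apply/matrixP => i j; rewrite mxE !mulmx_back_diag !mxE !rev_ordE.
by congr a; ring.
Qed.

Lemma back_diag_circulant (m : nat) (a : 'I_m.+2 -> int) :
  back_diag m.+2 *m circulant a = (circulant a)^T *m back_diag m.+2.
Proof.
rewrite -[LHS]trmxK trmx_mul tr_back_diag tr_circulant.
by rewrite tr_circulant_back_diag.
Qed.

Lemma back_diag_tr_circulant (m : nat) (a : 'I_m.+2 -> int) :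
  back_diag m.+2 *m (circulant a)^T = circulant a *m back_diag m.+2.
Proof. by rewrite -[RHS]tr_circulant_back_diag trmx_mul tr_back_diag. Qed.

Lemma tr_opp_mx (m n : nat) (M : 'M[int]_(m, n)) : (- M)^T = - M^T.
Proof. exact: raddfN. Qed.

(** * The Goethals-Seidel array of circulant matrices *)

Definition pm_mx (m n : nat) (M : 'M[int]_(m, n)) : Prop :=
  forall i j, M i j = 1 \/ M i j = -1.

Lemma pm_mxN (m n : nat) (M : 'M[int]_(m, n)) : pm_mx M -> pm_mx (- M).
Proof. by move=> H i j; rewrite mxE; case: (H i j) => ->; [right|left]. Qed.

Lemma pm_mxT (m n : nat) (M : 'M[int]_(m, n)) : pm_mx M -> pm_mx M^T.
Proof. by move=> H i j; rewrite mxE. Qed.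

Lemma pm_mx_back_diag (m n : nat) (M : 'M[int]_(m, n)) :
  pm_mx M -> pm_mx (M *m back_diag n).
Proof. by move=> H i j; rewrite mulmx_back_diag. Qed.

Lemma pm_mx_block (m1 m2 n1 n2 : nat) (A : 'M[int]_(m1, n1))
    (B : 'M[int]_(m1, n2)) (C : 'M[int]_(m2, n1)) (D : 'M[int]_(m2, n2)) :
  pm_mx A -> pm_mx B -> pm_mx C -> pm_mx D -> pm_mx (block_mx A B C D).
Proof.
by move=> HA HB HC HD i j; rewrite !mxE; case: splitP => k _; rewrite !mxE;
  case: splitP.
Qed.

Lemma pm_mx_circ (n : nat) (X : {set 'Z_n}) : pm_mx (circ X).
Proof. by move=> i j; rewrite mxE /pm_vec; case: ifP; [right|left]. Qed.

Lemma pm_mx_GS (n : nat) (P1 P2 P3 P4 : 'M[int]_n) :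
  pm_mx P1 -> pm_mx P2 -> pm_mx P3 -> pm_mx P4 -> pm_mx (GS P1 P2 P3 P4).
Proof.
by move=> *; do 2!apply: pm_mx_block;
  repeat (exact || apply: pm_mxN || apply: pm_mx_back_diag || apply: pm_mxT).
Qed.

(** Apart from P1, every block of the array is a circulant times R, hence
    symmetric, and it occurs at transposed positions with opposite signs. *)
Lemma GS_skew (m : nat) (a1 a2 a3 a4 : 'I_m.+2 -> int) :
  skew_symmetric (circulant a1 - 1%:M) ->
  skew_symmetric (GS (circulant a1) (circulant a2) (circulant a3) (circulant a4)
    - 1%:M).
Proof.
rewrite /skew_symmetric /GS => skew1.
rewrite !(scalar_mx_block, opp_block_mx, add_block_mx, tr_block_mx).
rewrite skew1 !oppr0 !addr0 !(tr_opp_mx, tr_block_mx, opp_block_mx).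
by rewrite !tr_circulant !tr_circulant_back_diag !opprK.
Qed.

(** Each term of a block of the Gram matrix is a word in the P's, their
    transposes and R. Moving R to the right and sorting the commuting factors
    gives a normal form in which equal terms are recognized. *)
Lemma GS_gram (m : nat) (a1 a2 a3 a4 : 'I_m.+2 -> int) (c : int) :
  let P1 := circulant a1 in let P2 := circulant a2 in
  let P3 := circulant a3 in let P4 := circulant a4 in
  P1 *m P1^T + P2 *m P2^T + (P3 *m P3^T + P4 *m P4^T) = c%:M ->
  GS P1 P2 P3 P4 *m (GS P1 P2 P3 P4)^T = c%:M.
Proof.
move=> P1 P2 P3 P4 gramE.
have PP := (circulantC a2 a1, circulantC a3 a1, circulantC a3 a2,
  circulantC a4 a1, circulantC a4 a2, circulantC a4 a3).
have TP a b : (circulant a)^T *m circulant b = circulant b *m (circulant a)^T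
    :> 'M_m.+2 by rewrite tr_circulant circulantC.
have TT a b : (circulant a)^T *m (circulant b)^T
    = (circulant b)^T *m (circulant a)^T :> 'M_m.+2.
  by rewrite -!trmx_mul circulantC.
have {}TP := (TP a2 a1, TP a3 a1, TP a4 a1, TP a2 a2, TP a3 a2, TP a4 a2,
  TP a2 a3, TP a3 a3, TP a4 a3, TP a2 a4, TP a3 a4, TP a4 a4).
have {}TT := (TT a3 a2, TT a4 a2, TT a4 a3).
have RP := (back_diag_circulant a2, back_diag_circulant a3,
  back_diag_circulant a4).
have RT := (back_diag_tr_circulant a1, back_diag_tr_circulant a2,
  back_diag_tr_circulant a3, back_diag_tr_circulant a4).
(* The facts above are all that is needed of circulants; making the P's opaque
   keeps the rewriting of the sixteen blocks syntactic. *)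
rewrite -/P1 -/P2 -/P3 -/P4 in PP TP TT RP RT.
clearbody P1 P2 P3 P4.
have RR (X Y : 'M_m.+2) : X *m back_diag m.+2 *m (back_diag m.+2 *m Y) = X *m Y.
  by rewrite mulmxA -[X *m _ *m _]mulmxA back_diag_sq mulmx1.
have trR := tr_back_diag m.+2.
rewrite /GS; move: (back_diag m.+2) => R in RP RT RR trR *.
(* Rewriting with this rule first avoids cancelling double negations in all
   sixteen blocks at once, which is slow. *)
have NN (X Y : 'M_m.+2) : (- X) *m (- Y) = X *m Y.
  by rewrite mulNmx mulmxN opprK.
rewrite !(tr_block_mx, mulmx_block, add_block_mx).
rewrite !tr_opp_mx !trmx_mul trR !trmxK.
rewrite !NN !(mulNmx, mulmxN).
rewrite !RR -![_ *m R *m _]mulmxA !(RP, RT) !mulmxA !(PP, TP, TT).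
rewrite !scalar_mx_block -(block_mx0 int m.+2 m.+2 m.+2 m.+2).
(* Every off-diagonal block is now a sum of two terms and their opposites. *)
congr block_mx; congr block_mx => //;
  try by apply/eqP; rewrite addr_eq0 ?addNr ?subrr ?oppr0 //
    !opprD ?opprK // addrC.
all: rewrite -gramE; first [by congr (_ + _); exact: addrC
  | by rewrite addrC | by rewrite addrC; congr (_ + _); exact: addrC].
Qed.

(** * Autocorrelations of sign sequences *)

Definition disagreements (b : seq bool) (s : nat) : nat :=
  count (fun p => p.1 (+) p.2) (zip b (rot s b)).

(** Each position contributes 1 when the two signs agree and -1 when they
    differ. *)
Lemma autocorrelation (m : nat) (b : seq bool) (s : 'I_m.+2) :
  size b = m.+2 ->
  let a (i : 'I_m.+2) : int := (-1) ^+ nth false b i in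
  \sum_i a i * a (i + s) = (m.+2)%:R - (disagreements b s)%:R *+ 2.
Proof.
move=> sz_b a.
have sz_zip : size (zip b (rot s b)) = m.+2.
  by rewrite size_zip size_rot sz_b minnn.
have sign_sum (l : seq (bool * bool)) :
    \sum_(p <- l) (-1) ^+ (p.1 (+) p.2)
    = (size l)%:R - (count (fun p => p.1 (+) p.2) l)%:R *+ 2 :> int.
  elim: l => [|p l IH]; first by rewrite big_nil subrr.
  rewrite big_cons IH /= natrD -natr1.
  by case: (p.1 (+) p.2); rewrite ?expr1 ?expr0 /=; ring.
have -> : (m.+2)%:R = (size (zip b (rot s b)))%:R :> int by rewrite sz_zip.
rewrite -sign_sum (big_nth (false, false)) sz_zip.
rewrite big_mkord; apply: eq_bigr => i _.
rewrite nth_zip ?size_rot // signr_addb /a; congr (_ * (-1) ^+ _).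
rewrite nth_cat size_drop nth_drop sz_b /= addnC.
have [lt_is|ge_is] := ltnP.
  by rewrite modn_small // -ltn_subRL.
have le_s : (s <= m.+2)%N by apply: ltnW.
have lt_k : (i - (m.+2 - s) < s)%N by rewrite ltn_subLR // subnK.
have -> : (s + i = i - (m.+2 - s) + m.+2)%N.
  by rewrite -{1}(subnK ge_is) addnCA subnKC.
by rewrite modnDr modn_small ?nth_take // (ltn_trans lt_k).
Qed.

Lemma circulant_gram (m : nat) (a : 'I_m.+2 -> int) (i j : 'I_m.+2) :
  (circulant a *m (circulant a)^T) i j = \sum_k a k * a (k + (i - j)).
Proof.
rewrite mxE (reindex_inj (addIr i)) /=; apply: eq_bigr => k _.
by rewrite !mxE addrK addrA.
Qed.

(** The conditions on X1 say that its sign sequence is 1 at 0 and odd elsewhere,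
    so that circ X1 minus the identity is skew-symmetric. The one on the
    disagreement counts makes the four autocorrelations cancel: at a nonzero
    shift their sum is 4n - 2 (2n). *)
Lemma GS_circ_skew_hadamard (m : nat) (X1 X2 X3 X4 : {set 'Z_m.+2})
    (b1 b2 b3 b4 : seq bool) :
  let indicates b (X : {set 'Z_m.+2}) :=
    size b = m.+2 /\ forall i : 'Z_m.+2, (i \in X) = nth false b i in
  indicates b1 X1 -> indicates b2 X2 -> indicates b3 X3 -> indicates b4 X4 ->
  0 \notin X1 -> (forall i : 'Z_m.+2, i != 0 -> (- i \in X1) = (i \notin X1)) ->
  (forall s, (0 < s < m.+2)%N ->
     disagreements b1 s + disagreements b2 s +
     (disagreements b3 s + disagreements b4 s) = (m.+2).*2)%N ->
  skew_hadamard (GS (circ X1) (circ X2) (circ X3) (circ X4)).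
Proof.
move=> indicates b1P b2P b3P b4P X1_0 X1_N dis.
split; first split.
- by apply: pm_mx_GS; apply: pm_mx_circ.
- rewrite !circE; apply: GS_gram; apply/matrixP => i j.
  pose a (b : seq bool) (k : 'I_m.+2) : int := (-1) ^+ nth false b k.
  have gram b X : indicates b X ->
      (circulant (pm_vec X) *m (circulant (pm_vec X))^T) i j
      = \sum_k a b k * a b (k + (i - j)).
    move=> [_ bX]; rewrite circulant_gram; apply: eq_bigr => k _.
    by rewrite /pm_vec !bX /a; do 2!case: nth.
  have addE (M N : 'M[int]_m.+2) : (M + N) i j = M i j + N i j by rewrite mxE.
  rewrite !addE (gram _ _ b1P) (gram _ _ b2P) (gram _ _ b3P) (gram _ _ b4P).
  rewrite mxE; have [->|neq_ij] := eqVneq i j.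
    have sq b : \sum_k a b k * a b (k + (j - j)) = (m.+2)%:R.
      rewrite -[in RHS](card_ord m.+2) -sumr_const; apply: eq_bigr => k _.
      by rewrite subrr addr0 /a; case: nth.
    by rewrite !sq -!natrD mulr1n.
  case: b1P b2P b3P b4P => [sz1 _] [sz2 _] [sz3 _] [sz4 _].
  rewrite !autocorrelation //.
  have /dis : (0 < (i - j)%R < m.+2)%N.
    rewrite ltn_ord andbT lt0n -[0%N]/(val (0 : 'I_m.+2)).
    by rewrite (inj_eq val_inj) subr_eq0.
  move: (disagreements b1 _) (disagreements b2 _)
    (disagreements b3 _) (disagreements b4 _) => d1 d2 d3 d4.
  move=> /(congr1 (fun d : nat => d%:R : int)); rewrite -addnn !natrD => d_sum.
  have -> : forall N : int, N - d1%:R *+ 2 + (N - d2%:R *+ 2) +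
      (N - d3%:R *+ 2 + (N - d4%:R *+ 2))
      = (N + N - (d1%:R + d2%:R + (d3%:R + d4%:R))) *+ 2 by move=> N; ring.
  by rewrite d_sum subrr mul0rn.
- rewrite !circE; apply: GS_skew.
  apply/matrixP => i j; rewrite !mxE.
  rewrite -(opprB i j) /pm_vec.
  have [->|neq_ij] := eqVneq i j.
    by rewrite subrr oppr0 (negbTE X1_0) subrr.
  rewrite X1_N ?subr_eq0 //.
  by case: (i - j \in X1).
Qed.

(** * Unions of cosets modulo 109 *)

(** The enumeration underlying a set comprehension does not reduce, so the
    cosets are also listed as sequences on which membership can be evaluated. *)
Definition coset_residues (k : nat) : seq 'Z_109 :=
  let c := [seq coset_reps`_k./2 * h | h <- [:: 1; 45; 63]] in
  if odd k then [seq - x | x <- c] else c.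

Definition indicator (J : seq nat) : seq bool :=
  let r := [seq nat_of_ord x | x <- flatten (map coset_residues J)] in
  mkseq (fun i => i \in r) 109.

Lemma mem_alpha (k : nat) (x : 'Z_109) :
  (x \in alpha k) = (x \in coset_residues k).
Proof.
have mem_H h : (h \in H) = (h \in [:: 1; 45; 63]) by rewrite !inE orbA.
have mem_even y :
    (y \in even_coset k./2)
    = (y \in [seq coset_reps`_k./2 * h | h <- [:: 1; 45; 63]]).
  by apply/imsetP/mapP => -[h hH ->]; exists h; rewrite // ?mem_H // -mem_H.
rewrite /alpha /coset_residues; case: odd; last exact: mem_even.
by apply/imsetP/mapP => -[y yE ->]; exists y; rewrite // ?mem_even // -mem_even.
Qed.

Lemma mem_coset_union (J : seq nat) (x : 'Z_109) :
  (x \in coset_union J) = nth false (indicator J) x.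
Proof.
rewrite nth_mkseq ?ltn_ord // (mem_map val_inj) /coset_union.
elim: J => [|k J IH]; first by rewrite big_nil inE.
by rewrite big_cons inE IH mem_alpha /= mem_cat.
Qed.

(** The number 218 is twice the modulus. Shift 0 is left out: there every
    sequence agrees with itself. *)
Definition skew_certificate (J1 J2 J3 J4 : seq nat) : bool :=
  let b1 := indicator J1 in let b2 := indicator J2 in
  let b3 := indicator J3 in let b4 := indicator J4 in
  [&& ~~ nth false b1 0,
      all (fun i => nth false b1 (109 - i) != nth false b1 i) (iota 1 108)
    & all (fun s => disagreements b1 s + disagreements b2 s +
        (disagreements b3 s + disagreements b4 s) == 218)%N (iota 1 108)].

Lemma certificate_skew_hadamard (J1 J2 J3 J4 : seq nat) :
  skew_certificate J1 J2 J3 J4 ->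
  @skew_hadamard 436 (GS (circ (coset_union J1)) (circ (coset_union J2))
    (circ (coset_union J3)) (circ (coset_union J4))).
Proof.
case/and3P=> b1_0 /allP b1_N /allP dis.
have indicates J : size (indicator J) = 109 /\ forall i : 'Z_109,
    (i \in coset_union J) = nth false (indicator J) i.
  by split; [exact: size_mkseq | exact: mem_coset_union].
apply: (@GS_circ_skew_hadamard 107 _ _ _ _ _ _ _ _ (indicates J1) (indicates J2)
  (indicates J3) (indicates J4)).
- by rewrite mem_coset_union.
- move=> i i_neq0; rewrite !mem_coset_union.
  have i_gt0 : (0 < i)%N by rewrite lt0n.
  have /b1_N : (i : nat) \in iota 1 108 by rewrite mem_iota i_gt0 ltn_ord.
  rewrite /= modn_small; first by do 2!case: nth.
  by rewrite -subn_gt0 subKn // ltnW.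
- by move=> s s_range; apply/eqP/dis; rewrite mem_iota.
Qed.

Theorem proposition2p2 :
  @skew_hadamard 436 (GS (circ A1) (circ A2) (circ A3) (circ A4)) /\
  @skew_hadamard 436 (GS (circ B1) (circ B2) (circ B3) (circ B4)).
Proof.
by split; apply: certificate_skew_hadamard; vm_compute.
Qed.
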